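(* Let $A$ be a real nonassociative algebra equipped with a norm $\|\cdot\|$ making $(A,\|\cdot\|)$ a normed space, and suppose the norm satisfies the square inequality. Let $\eta$ be any positive real number such that $\|u^{2}\|\geq \eta\|u\|^{2}$ for all $u\in A$. Then for every $c\in A$ the following holds: if for some positive integer $n_{0}$ $$\|f_{c}^{n_{0}}(0)\|>2\eta^{-1},$$ then the orbit of the element $0$ under $f_c$ is unbounded.
   Context: A real nonassociative algebra is a real vector space $A$ with a bilinear multiplication (not necessarily associative, commutative or unital). All real nonassociative algebras are assumed nonzero and of dimension at least $2$ (possibly infinite-dimensional). A norm $\|\cdot\|$ on $A$ satisfies the square inequality if there is a positive real number $\eta$ such that $\|u^{2}\|\geq\eta\|u\|^{2}$ for all $u\in A$, where $u^2=u\cdot u$. For $c\in A$, $f_c:A\to A$ is the map $f_c(u)=u^2+c$; $f_c^{1}=f_c$ and $f_c^{n}(u)=f_c(f_c^{n-1}(u))$. The orbit of $u$ is $\{f_c^n(u): n \text{ a positive integer}\}$; it is bounded if there is a real $\zeta>0$ with $\|f_c^n(u)\|\leq\zeta$ for every positive integer $n$, and unbounded otherwise. *)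

(* Defs.v *)
From mathcomp Require Import all_boot all_order all_algebra.
From mathcomp Require Import sesquilinear.
From mathcomp Require Import all_classical all_reals all_analysis.

Set Implicit Arguments.
Unset Strict Implicit.
Unset Printing Implicit Defensive.

Import Order.TTheory GRing.Theory Num.Theory.
Import numFieldNormedType.Exports.

Local Open Scope ring_scope.

(* A real nonassociative algebra is given by its underlying vector space [A]
   and its product [mul : {bilinear A -> A -> A}]: no associativity,
   commutativity, unit or continuity of the product is assumed. *)

Definition dim_ge2 (R : realType) (A : lmodType R) : Prop :=
  exists x y : A, forall a b : R, a *: x + b *: y = 0 -> a = 0 /\ b = 0.

Definition square_bound (R : realType) (A : normedModType R)
    (mul : {bilinear A -> A -> A}) (eta : R) : Prop :=
  0 < eta /\ forall u : A, `|mul u u| >= eta * `|u| ^+ 2.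

Definition square_inequality (R : realType) (A : normedModType R)
    (mul : {bilinear A -> A -> A}) : Prop :=
  exists eta : R, square_bound mul eta.

Definition quad_map (R : realType) (A : lmodType R)
    (mul : {bilinear A -> A -> A}) (c u : A) : A :=
  mul u u + c.

Definition bounded_orbit (R : realType) (A : normedModType R)
    (mul : {bilinear A -> A -> A}) (c u : A) : Prop :=
  exists zeta : R, 0 < zeta /\
    forall n : nat, (0 < n)%N -> `|iter n (quad_map mul c) u| <= zeta.

Definition unbounded_orbit (R : realType) (A : normedModType R)
    (mul : {bilinear A -> A -> A}) (c u : A) : Prop :=
  ~ bounded_orbit mul c u.

(* Main.v *)
Require Import Defs.
From mathcomp Require Import all_boot all_order all_algebra.
From mathcomp Require Import sesquilinear lra.
From mathcomp Require Import all_classical all_reals all_analysis.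

Import Order.TTheory GRing.Theory Num.Theory.
Import numFieldNormedType.Exports.

Local Open Scope ring_scope.

(** The number [2 / eta] is an escape radius.  If [|u| >= |c|], then the square
    inequality and the triangle inequality give
    [|u^2 + c| >= eta |u|^2 - |c| >= |u| + (eta |u| - 2) |u|], so once
    [|u| > 2 / eta] each iteration lengthens [u] by an amount that does not
    decrease along the orbit: by [norm_iter_quad_map_ge] the norms grow at least
    linearly, and they are unbounded because the reals are archimedean.

    It remains to find a point [x] of the orbit of [0] with both
    [|x| > 2 / eta] and [|x| >= |c|].  If [|c| <= 2 / eta], the given iterate is
    such a point.  Otherwise [c], the first iterate of [0], is one. *)

Lemma quad_map0 {R : realType} {A : normedModType R}
    (mul : {bilinear A -> A -> A}) (c : A) : quad_map mul c 0 = c.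
Proof. by rewrite /quad_map linear0l add0r. Qed.

Lemma norm_quad_map_ge {R : realType} {A : normedModType R}
    {mul : {bilinear A -> A -> A}} {eta : R} {c u : A} :
  square_bound mul eta -> `|c| <= `|u| ->
  `|u| + (eta * `|u| - 2) * `|u| <= `|quad_map mul c u|.
Proof.
move=> heta cu; have := heta.2 u; have := lerB_normD (mul u u) c.
rewrite /quad_map expr2; lra.
Qed.

(** Linear growth already forces unboundedness, so the increment at [x] is kept
    as a uniform lower bound for all later increments, although these grow. *)
Lemma norm_iter_quad_map_ge {R : realType} {A : normedModType R}
    {mul : {bilinear A -> A -> A}} {eta : R} {c x : A} (k : nat) :
  square_bound mul eta -> 2 / eta < `|x| -> `|c| <= `|x| ->
  `|x| + k%:R * ((eta * `|x| - 2) * `|x|) <= `|iter k (quad_map mul c) x|.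
Proof.
move=> heta; have [eta0 _] := heta.
rewrite ltr_pdivrMr // mulrC => xlarge cx.
have d0 : 0 <= (eta * `|x| - 2) * `|x| by rewrite mulr_ge0 // subr_ge0 ltW.
elim: k => [|k IHk]; first by rewrite mul0r addr0.
have xy : `|x| <= `|iter k (quad_map mul c) x|.
  by apply: le_trans IHk; rewrite lerDl mulr_ge0.
rewrite iterS; apply: le_trans (norm_quad_map_ge heta (le_trans cx xy)).
rewrite -natr1 mulrDl mul1r addrA lerD // ler_pM //.
  by rewrite subr_ge0 ltW.
by rewrite lerD2r ler_pM2l.
Qed.

Lemma unbounded_orbit_of_escape {R : realType} {A : normedModType R}
    {mul : {bilinear A -> A -> A}} {eta : R} {c u : A} (m : nat) :
  square_bound mul eta ->
  2 / eta < `|iter m (quad_map mul c) u| ->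
  `|c| <= `|iter m (quad_map mul c) u| -> unbounded_orbit mul c u.
Proof.
set x := iter m _ u => heta xlarge cx [zeta [zeta0 hzeta]].
have [eta0 _] := heta.
have x0 : 0 < `|x| by apply: lt_trans xlarge; rewrite divr_gt0.
have d0 : 0 < (eta * `|x| - 2) * `|x|.
  by rewrite mulr_gt0 // subr_gt0 mulrC -ltr_pdivrMr.
set d := (eta * `|x| - 2) * `|x| in d0.
(* The successor keeps the index [k + m] positive. *)
pose k := (Num.bound (zeta / d)).+1.
have zk : zeta < k%:R * d.
  rewrite -ltr_pdivrMr //.
  have zd : 0 <= zeta / d by rewrite ltW ?divr_gt0.
  by apply: lt_le_trans (archi_boundP zd) _; rewrite ler_nat.
have := norm_iter_quad_map_ge k heta xlarge cx.
have := hzeta (k + m)%N isT.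
rewrite iterD -/x -/d; lra.
Qed.

Theorem theorem3p2 (R : realType) (A : normedModType R)
    (mul : {bilinear A -> A -> A})
    (hdim : dim_ge2 A)
    (hsq : square_inequality mul)
    (eta : R) (heta : square_bound mul eta)
    (c : A) :
  (exists n0 : nat, (0 < n0)%N /\
     `|iter n0 (quad_map mul c) (0 : A)| > 2 * eta^-1) ->
  unbounded_orbit mul c 0.
Proof.
move=> [n0 [_ n0large]].
have [c_small|c_large] := leP `|c| (2 / eta).
  exact: unbounded_orbit_of_escape heta n0large
           (le_trans c_small (ltW n0large)).
by apply: (unbounded_orbit_of_escape 1 heta); rewrite /= quad_map0.
Qed.
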